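(* Let $\mathcal H_A=\mathbb C^2$ and $\mathcal H_B=\mathbb C^d$ with $d\ge1$. For any two nondegenerate spectra $\Lambda=(\lambda_1,\lambda_2)$ and $\Lambda'=(\lambda_1',\lambda_2')$ (real numbers with $\lambda_1\ne\lambda_2$, $\lambda_1'\neq\lambda_2'$), the corresponding local quantum uncertainties coincide up to a multiplicative constant: there is a constant $c>0$, depending only on $\Lambda$ and $\Lambda'$, such that $\mathcal U_A^{\Lambda}(\rho)=c\,\mathcal U_A^{\Lambda'}(\rho)$ for every density matrix $\rho$ on $\mathbb C^2\otimes\mathbb C^d$.
   Context: For a density matrix $\rho$ and a Hermitian operator $K$, the Wigner-Yanase skew information is $\mathcal I(\rho,K)=-\tfrac12\mathrm{Tr}\{[\rho^{1/2},K]^2\}$. For a bipartite state $\rho$ on $\mathcal H_A\otimes\mathcal H_B$ and a nondegenerate spectrum $\Lambda$, the local quantum uncertainty is $\mathcal U_A^\Lambda(\rho)=\min_{K_A}\mathcal I(\rho,K_A\otimes\mathbb I_B)$, where the minimum is over all Hermitian operators $K_A$ on $\mathcal H_A$ with spectrum $\Lambda$, i.e. $K_A=V\,\mathrm{diag}(\Lambda)\,V^\dagger$ with $V$ unitary. *)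

(* Defs.v *)
From HB Require Import structures.
From mathcomp Require Import all_boot all_order all_algebra.
From mathcomp Require Import complex mxtens.
From mathcomp Require Import all_classical all_reals all_analysis.

Set Implicit Arguments.
Unset Strict Implicit.
Unset Printing Implicit Defensive.

Import Order.TTheory GRing.Theory Num.Theory.
Import numFieldNormedType.Exports.

Local Open Scope classical_set_scope.
Local Open Scope ring_scope.
Local Open Scope complex_scope.
Local Open Scope sesquilinear_scope.

(* Operators on C^n are matrices over R[i], where R is a model of the real
   numbers. C^m (x) C^n is C^(m * n), with the Kronecker product *t of mxtens.
   On R[i], 0 <= z means that z is real and nonnegative. *)

Section Definitions.
Variable R : realType.
Local Notation C := R[i].

Definition psdmx n (A : 'M[C]_n) : Prop :=
  A \is hermsymmx /\ forall u : 'rV[C]_n, 0 <= (u *m A *m u ^t*) 0 0.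

Definition density n (rho : 'M[C]_n) : Prop := psdmx rho /\ \tr rho = 1.

(* Functional calculus: A = P^t* diag(a) P gives P^t* diag(sqrt a) P, with P
   unitary. It is the positive square root when A is positive semidefinite
   (sqrtmx_psd, sqrtmxK). *)
Definition sqrtmx n (A : 'M[C]_n) : 'M[C]_n :=
  (spectralmx A) ^t* *m diag_mx (map_mx sqrtC (spectral_diag A))
    *m spectralmx A.

Definition commutator n (A B : 'M[C]_n) : 'M[C]_n := A *m B - B *m A.

Definition skew_info n (rho K : 'M[C]_n) : C :=
  - 2^-1 * \tr (commutator (sqrtmx rho) K *m commutator (sqrtmx rho) K).

Definition has_spectrum m (Lambda : 'rV[R]_m) (K : 'M[C]_m) : Prop :=
  exists2 V : 'M[C]_m, V \is unitarymx &
    K = V *m diag_mx (map_mx (real_complex R) Lambda) *m V ^t*.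

(* The skew information is real for the operators at hand (skew_info_real), and
   the infimum is a minimum (lqu_attained). *)
Definition lqu m n (Lambda : 'rV[R]_m) (rho : 'M[C]_(m * n)) : R :=
  inf [set complex.Re (skew_info rho (K *t (1%:M : 'M[C]_n)))
      | K in [set K : 'M[C]_m | has_spectrum Lambda K]].

End Definitions.

Section SquareRoot.
Variable R : realType.
Local Notation C := R[i].

Lemma adjmxM m n p (A : 'M[C]_(m, n)) (B : 'M[C]_(n, p)) :
  (A *m B) ^t* = B ^t* *m A ^t*.
Proof. by rewrite trmx_mul map_mxM. Qed.

Lemma hermsymmxP n (A : 'M[C]_n) : reflect (A ^t* = A) (A \is hermsymmx).
Proof.
apply: (iffP (is_hermitianmxP _ _ _)); rewrite expr0 scale1r; exact: esym.
Qed.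

Lemma psd_diag_ge0 n (A : 'M[C]_n) i : psdmx A -> 0 <= spectral_diag A 0 i.
Proof.
move=> [hA pA].
have /orthomx_spectralP eA := hermitian_normalmx hA.
have uP := spectral_unitarymx A; move: eA uP.
set P := spectralmx A; set a := spectral_diag A => eA uP.
rewrite invmx_unitary // in eA.
have := pA (row i P).
have -> : row i P = delta_mx 0 i *m P by rewrite rowE.
rewrite adjmxM eA !mulmxA.
rewrite -[_ *m P *m P ^t*]mulmxA (unitarymxP uP) mulmx1.
rewrite -[_ *m P *m P ^t*]mulmxA (unitarymxP uP) mulmx1.
by rewrite -rowE row_diag_mx trmx_delta map_delta_mx -scalemxAl mul_delta_mx
  !mxE !eqxx mulr1.
Qed.

Lemma sqrtmxK n (A : 'M[C]_n) : psdmx A -> sqrtmx A *m sqrtmx A = A.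
Proof.
move=> [hA pA]; rewrite /sqrtmx.
have /orthomx_spectralP eA := hermitian_normalmx hA.
have uP := spectral_unitarymx A; rewrite invmx_unitary // in eA.
rewrite [RHS]eA !mulmxA -[_ *m _ *m (spectralmx A) ^t*]mulmxA.
rewrite (unitarymxP uP) mulmx1 -[_ *m diag_mx _ *m diag_mx _]mulmxA.
congr (_ *m _ *m _); rewrite mulmx_diag; congr diag_mx.
by apply/rowP => i; rewrite !mxE -expr2 sqrtCK.
Qed.

Lemma sqrtmx_psd n (A : 'M[C]_n) : psdmx A -> psdmx (sqrtmx A).
Proof.
move=> pA; set s := map_mx sqrtC (spectral_diag A).
have s0 i : 0 <= s 0 i by rewrite mxE sqrtC_ge0; exact: psd_diag_ge0.
split=> [|u].
  apply/hermsymmxP; rewrite /sqrtmx !adjmxM trmxCK mulmxA.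
  congr (_ *m _ *m _); rewrite tr_diag_mx map_diag_mx; congr diag_mx.
  by apply/rowP => i; rewrite mxE; apply/CrealP/ger0_real.
rewrite /sqrtmx !mulmxA -mulmxA -[spectralmx A *m _]trmxCK adjmxM trmxCK.
rewrite mxE sumr_ge0 // => i _.
rewrite mul_mx_diag !mxE mulrAC mulr_ge0 ?mul_conjC_ge0 ?sqrtC_ge0 //.
exact: psd_diag_ge0.
Qed.

Lemma skew_info_real n (rho K : 'M[C]_n) : psdmx rho -> K \is hermsymmx ->
  skew_info rho K = (complex.Re (skew_info rho K))%:C.
Proof.
move=> /sqrtmx_psd[/hermsymmxP hS _] /hermsymmxP hK; rewrite /skew_info.
move: (sqrtmx rho) hS => S hS; set X := commutator S K.
have hX : X ^t* = - X by rewrite linearB map_mxB !adjmxM hS hK opprB.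
have rT : \tr (X *m X) \is Num.real.
  apply/CrealP; have -> : (\tr (X *m X))^*%R = \tr ((X *m X) ^t*).
    by rewrite trace_map_mx mxtrace_tr.
  by rewrite adjmxM hX !mulNmx !mulmxN !opprK.
by rewrite RRe_real // rpredM // rpredN rpredV realn.
Qed.

Lemma has_spectrum_herm m (Lambda : 'rV[R]_m) (K : 'M[C]_m) :
  has_spectrum Lambda K -> K \is hermsymmx.
Proof.
move=> [V _ ->]; apply/hermsymmxP; rewrite !adjmxM trmxCK mulmxA.
congr (_ *m _ *m _); rewrite tr_diag_mx map_diag_mx; congr diag_mx.
by apply/rowP => i; rewrite !mxE; apply/CrealP/complex_realP; eexists.
Qed.

End SquareRoot.

Section Attained.
Variable R : realType.
Local Notation C := R[i].

Section Continuity.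
Variable T : topologicalType.

Definition ccont (g : T -> C) : Prop :=
  continuous (fun x => complex.Re (g x)) /\
  continuous (fun x => complex.Im (g x)).

Definition mxcont p q (F : T -> 'M[C]_(p, q)) : Prop :=
  forall i j, ccont (fun x => F x i j).

Lemma ccont_cst c : ccont (fun=> c).
Proof. by split=> x; exact: cvg_cst. Qed.

Lemma ccontN g : ccont g -> ccont (fun x => - g x).
Proof.
move=> [gr gi]; split=> x.
- under eq_fun do rewrite raddfN; apply: cvgN; exact: gr.
- under eq_fun do rewrite raddfN; apply: cvgN; exact: gi.
Qed.

Lemma ccontD g h : ccont g -> ccont h -> ccont (fun x => g x + h x).
Proof.
move=> [gr gi] [hr hi]; split=> x.
- under eq_fun do rewrite raddfD; exact: cvgD (gr x) (hr x).
- under eq_fun do rewrite raddfD; exact: cvgD (gi x) (hi x).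
Qed.

Lemma ccontM g h : ccont g -> ccont h -> ccont (fun x => g x * h x).
Proof.
move=> [gr gi] [hr hi]; split=> x.
- rewrite (_ : (fun _ => _) = fun x => complex.Re (g x) * complex.Re (h x)
    - complex.Im (g x) * complex.Im (h x)).
    by apply: cvgB; apply: cvgM; [exact: gr|exact: hr|exact: gi|exact: hi].
  by apply/funext => y; case: (g y) (h y) => [a b] [].
- rewrite (_ : (fun _ => _) = fun x => complex.Re (g x) * complex.Im (h x)
    + complex.Im (g x) * complex.Re (h x)).
    by apply: cvgD; apply: cvgM; [exact: gr|exact: hi|exact: gi|exact: hr].
  by apply/funext => y; case: (g y) (h y) => [a b] [].
Qed.

Lemma ccontJ g : ccont g -> ccont (fun x => (g x)^*%R).
Proof.
move=> [gr gi]; split=> x.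
- rewrite (_ : (fun _ => _) = fun x => complex.Re (g x)); first exact: gr.
  by apply/funext => y; case: (g y).
- rewrite (_ : (fun _ => _) = fun x => - complex.Im (g x)).
    by apply: cvgN; exact: gi.
  by apply/funext => y; case: (g y).
Qed.

Lemma ccont_sum (I : finType) (g : I -> T -> C) :
  (forall i, ccont (g i)) -> ccont (fun x => \sum_i g i x).
Proof.
move=> gc; elim: (index_enum I) => [|i s IH].
  under eq_fun do rewrite big_nil; exact: ccont_cst.
under eq_fun do rewrite big_cons; exact: ccontD.
Qed.

Lemma mxcont_cst p q (A : 'M[C]_(p, q)) : mxcont (fun=> A).
Proof. by move=> i j; exact: ccont_cst. Qed.

Lemma mxcontM p q r (F : T -> 'M[C]_(p, q)) (G : T -> 'M[C]_(q, r)) :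
  mxcont F -> mxcont G -> mxcont (fun x => F x *m G x).
Proof.
move=> cF cG i j; under eq_fun do rewrite mxE.
by apply: ccont_sum => k; exact: ccontM.
Qed.

Lemma mxcontB p q (F G : T -> 'M[C]_(p, q)) :
  mxcont F -> mxcont G -> mxcont (fun x => F x - G x).
Proof.
move=> cF cG i j; under eq_fun do rewrite !mxE.
exact/ccontD/ccontN.
Qed.

Lemma mxcontJ p q (F : T -> 'M[C]_(p, q)) :
  mxcont F -> mxcont (fun x => F x ^t*).
Proof. by move=> cF i j; under eq_fun do rewrite !mxE; exact: ccontJ. Qed.

Lemma mxcont_tens p q r s (F : T -> 'M[C]_(p, q)) (B : 'M[C]_(r, s)) :
  mxcont F -> mxcont (fun x => F x *t B).
Proof.
move=> cF i j; under eq_fun do rewrite !mxE.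
exact/ccontM/ccont_cst.
Qed.

Lemma ccont_skew n (rho : 'M[C]_n) (F : T -> 'M[C]_n) :
  mxcont F -> ccont (fun x => skew_info rho (F x)).
Proof.
move=> cF; apply: ccontM; first exact: ccont_cst.
have cc : mxcont (fun x => commutator (sqrtmx rho) (F x)).
  by apply: mxcontB; apply: mxcontM => //; exact: mxcont_cst.
by apply: ccont_sum => i; exact: mxcontM.
Qed.

Lemma closed_mxcont p q (F : T -> 'M[C]_(p, q)) (A : 'M[C]_(p, q)) :
  mxcont F -> closed [set x | F x = A].
Proof.
move=> cF.
have -> : [set x | F x = A] = \bigcap_ij
    ([set x | complex.Re (F x ij.1 ij.2) = complex.Re (A ij.1 ij.2)] `&`
     [set x | complex.Im (F x ij.1 ij.2) = complex.Im (A ij.1 ij.2)]).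
  apply/seteqP; split=> [x /= Fx ij _ /=|x /= h];
    first by rewrite Fx.
  apply/matrixP => i j.
  by apply/eqP; rewrite eq_complex; have [-> ->] := h (i, j) I; rewrite !eqxx.
apply: closed_bigI => -[i j] _; have [cr ci] := cF i j.
apply: closedI.
- apply: (preimage_closed (f := fun x => complex.Re (F x i j))
    (D := [set y | y = complex.Re (A i j)])); last exact: closed_eq.
  by move=> x _; exact: cr.
- apply: (preimage_closed (f := fun x => complex.Im (F x i j))
    (D := [set y | y = complex.Im (A i j)])); last exact: closed_eq.
  by move=> x _; exact: ci.
Qed.

End Continuity.

Definition cmx_of_row m (x : 'rV[R]_(m * m + m * m)) : 'M[C]_m :=
  \matrix_(i, j) (x 0 (lshift _ (mxvec_index i j)) +i*
                  x 0 (rshift _ (mxvec_index i j))).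

Lemma cmx_of_row_surj m (V : 'M[C]_m) : exists x, cmx_of_row x = V.
Proof.
exists (row_mx (mxvec (map_mx (@complex.Re R) V))
               (mxvec (map_mx (@complex.Im R) V))).
apply/matrixP => i j; rewrite mxE row_mxEl row_mxEr !mxvecE !mxE.
by case: (V i j).
Qed.

Lemma mxcont_cmx_of_row m : mxcont (@cmx_of_row m).
Proof.
by move=> i j; split; under eq_fun do rewrite mxE /=; exact: coord_continuous.
Qed.

Lemma compact_unitary m :
  compact [set x : 'rV[R]_(m * m + m * m) | cmx_of_row x \is unitarymx].
Proof.
apply: bounded_closed_compact; last first.
  have -> : [set x : 'rV[R]_(m * m + m * m) | cmx_of_row x \is unitarymx] =
            [set x | cmx_of_row x *m (cmx_of_row x) ^t* = 1%:M].
    by apply/seteqP; split=> x /= /unitarymxP.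
  apply: closed_mxcont; apply: mxcontM; first exact: mxcont_cmx_of_row.
  exact/mxcontJ/mxcont_cmx_of_row.
exists 1; split=> // M M1 x /= /unitarymxP uV.
rewrite [leLHS]/Num.norm /= mx_normrE; apply/bigmax_leP; split.
  exact: le_trans ler01 (ltW M1).
move=> [k l] _ /=; rewrite ord1.
have V1 i j : (complex.Re (cmx_of_row x i j)) ^+ 2 +
    (complex.Im (cmx_of_row x i j)) ^+ 2 <= 1.
  rewrite -lecR add_Re2_Im2 normCK; move: (cmx_of_row x) uV => V uV.
  have /(congr1 (fun A : 'M[C]_m => A i i)) := uV.
  rewrite !mxE eqxx (bigD1 j) //= => uVi.
  have h (y z : C) : y = 1 -> z <= y -> z <= 1 by move=> ->.
  apply: h uVi _.
  rewrite !mxE lerDl; apply: sumr_ge0 => a _.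
  by rewrite !mxE mul_conjC_ge0.
suff : `|x 0 l| ^+ 2 <= 1.
  rewrite expr_le1 // => h; exact: le_trans h (ltW M1).
rewrite real_normK ?num_real //.
case: (split_ordP l) => a ->; case/mxvec_indexP: a => i j.
- by have := V1 i j; rewrite mxE /=; apply: le_trans; rewrite lerDl sqr_ge0.
- by have := V1 i j; rewrite mxE /=; apply: le_trans; rewrite lerDr sqr_ge0.
Qed.

Lemma lqu_attained m n (Lambda : 'rV[R]_m) (rho : 'M[C]_(m * n)) :
  exists K : 'M[C]_m, [/\ has_spectrum Lambda K,
    lqu Lambda rho = complex.Re (skew_info rho (K *t (1%:M : 'M[C]_n))) &
    forall K' : 'M[C]_m, has_spectrum Lambda K' ->
      lqu Lambda rho <= complex.Re (skew_info rho (K' *t (1%:M : 'M[C]_n)))].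
Proof.
pose K x : 'M[C]_m := cmx_of_row x *m
  diag_mx (map_mx (real_complex R) Lambda) *m (cmx_of_row x) ^t*.
pose f x := complex.Re (skew_info rho (K x *t (1%:M : 'M[C]_n))).
have cf : continuous f.
  have [] // : ccont (fun x => skew_info rho (K x *t (1%:M : 'M[C]_n))).
  apply/ccont_skew/mxcont_tens/mxcontM/mxcontJ/mxcont_cmx_of_row.
  exact/mxcontM/mxcont_cst/mxcont_cmx_of_row.
have [||x] := EVT_min_rV _ (@compact_unitary m) (f := f).
- have [x xE] := cmx_of_row_surj (1%:M : 'M[C]_m); exists x => /=.
  by rewrite xE; apply/unitarymxP; rewrite trmx1 map_mx1 mulmx1.
- exact: continuous_subspaceT.
move=> /set_mem ux xmin.
have le_f K' : has_spectrum Lambda K' ->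
    f x <= complex.Re (skew_info rho (K' *t (1%:M : 'M[C]_n))).
  move=> [V uV ->]; have [y yV] := cmx_of_row_surj V.
  have uy : cmx_of_row y \is unitarymx by rewrite yV.
  by have := xmin y (mem_set uy); rewrite /f {2}/K yV.
have sx : has_spectrum Lambda (K x) by exists (cmx_of_row x).
have E : lqu Lambda rho = f x.
  apply/eqP; rewrite eq_le; apply/andP; split.
    apply: ge_inf; last by exists (K x).
    by exists (f x) => _ [K' sK' <-]; exact: le_f.
  apply: lb_le_inf; first by exists (f x); exists (K x).
  by move=> _ [K' sK' <-]; exact: le_f.
by exists (K x); split=> // K' sK'; rewrite E; exact: le_f.
Qed.

End Attained.

(* Main.v *)
Require Import Defs.
From mathcomp Require Import all_boot all_order all_algebra.
From mathcomp Require Import complex mxtens.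
From mathcomp Require Import all_classical all_reals all_analysis.
From mathcomp Require Import ring.

Import Order.TTheory GRing.Theory Num.Theory.

Local Open Scope ring_scope.
Local Open Scope complex_scope.
Local Open Scope sesquilinear_scope.

(** Any two nondegenerate two-point spectra are related by an affine map
    [x |-> a * x + b] with [a != 0]. It carries the observables with the one
    spectrum onto those with the other, and since the commutator ignores the
    scalar part, it multiplies the skew information by [a ^+ 2]. *)

Lemma commutator_affine (R : realType) n (A B : 'M[R[i]]_n) (a b : R[i]) :
  commutator A (a *: B + b%:M) = a *: commutator A B.
Proof.
rewrite /commutator mulmxDr mulmxDl -scalemxAr -scalemxAl scalar_mxC.
by rewrite opprD addrACA subrr addr0 scalerBr.
Qed.

Lemma skew_info_affine (R : realType) n (rho K : 'M[R[i]]_n) (a b : R[i]) :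
  skew_info rho (a *: K + b%:M) = a ^+ 2 * skew_info rho K.
Proof.
rewrite /skew_info commutator_affine -scalemxAl -scalemxAr scalerA mxtraceZ.
by rewrite mulrCA -expr2.
Qed.

(** Since the tensor product of two identities is the identity, a scalar shift of the local
    observable is a scalar shift on the whole space, to which [skew_info_affine] applies. *)
Lemma tensmx_affine (R : realType) m n (K : 'M[R[i]]_m) (a b : R[i]) :
  (a *: K + b%:M) *t (1%:M : 'M[R[i]]_n) =
    a *: (K *t (1%:M : 'M[R[i]]_n)) + b%:M.
Proof.
apply/matrixP => i j; case: (mxtens_indexP i) => i1 i2.
case: (mxtens_indexP j) => j1 j2.
rewrite !mxE !mxtens_indexK /= (can_eq (@mxtens_indexK _ _)) xpair_eqE.
by case: (i1 == j1); case: (i2 == j2); rewrite /= ?mulr1n ?mulr0n; ring.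
Qed.

(** The same unitary [V] works: conjugation by it is linear and fixes scalar matrices. *)
Lemma has_spectrum_affine (R : realType) m (Lambda : 'rV[R]_m)
    (K : 'M[R[i]]_m) (a b : R) :
  has_spectrum Lambda K ->
  has_spectrum (a *: Lambda + const_mx b) (a%:C *: K + (b%:C)%:M).
Proof.
move=> [V uV ->]; exists V => //.
rewrite map_mxD map_mxZ map_const_mx raddfD /= linearZ /= diag_const_mx.
rewrite mulmxDr mulmxDl -scalemxAr mul_mx_scalar -!scalemxAl.
by rewrite (unitarymxP uV) scalemx1.
Qed.

(** The affine image of a minimizer for [Lambda] is a competitor for the transformed spectrum. *)
Lemma lqu_affine_le (R : realType) m n (Lambda : 'rV[R]_m) (a b : R)
    (rho : 'M[R[i]]_(m * n)) :
  lqu (a *: Lambda + const_mx b) rho <= a ^+ 2 * lqu Lambda rho.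
Proof.
have [K [sK -> _]] := lqu_attained Lambda rho.
have [_ [_ _ lqu_le]] := lqu_attained (a *: Lambda + const_mx b) rho.
have := lqu_le _ (has_spectrum_affine R m Lambda K a b sK).
rewrite tensmx_affine skew_info_affine -rmorphXn /=.
(* The factor [a ^+ 2] is real, so it comes out of the real part. *)
by case: (skew_info _ _) => x y /=; rewrite mul0r subr0.
Qed.

Lemma lqu_affine (R : realType) m n (Lambda : 'rV[R]_m) (a b : R)
    (rho : 'M[R[i]]_(m * n)) : a != 0 ->
  lqu (a *: Lambda + const_mx b) rho = a ^+ 2 * lqu Lambda rho.
Proof.
move=> a0; apply/eqP; rewrite eq_le lqu_affine_le /=.
(* The reverse bound is the same inequality for the inverse map [x |-> a^-1 * x - a^-1 * b]. *)
have := lqu_affine_le R m n (a *: Lambda + const_mx b) a^-1 (- (a^-1 * b)) rho.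
rewrite [_ + const_mx (- _)](_ : _ = Lambda); last first.
  by apply/rowP => i; rewrite !mxE mulrDr mulKf // addrK.
by rewrite exprVn ler_pdivlMl // exprn_even_gt0.
Qed.

Theorem mainTheorem3 (R : realType) (Lambda Lambda' : 'rV[R]_2)
    (ndLambda : Lambda 0 0 <> Lambda 0 1)
    (ndLambda' : Lambda' 0 0 <> Lambda' 0 1) :
  exists c : R, 0 < c /\
    forall d : nat, (1 <= d)%N ->
      forall rho : 'M[R[i]]_(2 * d), density rho ->
        lqu Lambda rho = c * lqu Lambda' rho.
Proof.
have nd : Lambda 0 0 - Lambda 0 1 != 0 by rewrite subr_eq0; apply/eqP.
have nd' : Lambda' 0 0 - Lambda' 0 1 != 0 by rewrite subr_eq0; apply/eqP.
(* The slope is the ratio of the spectral gaps; the shift in [LambdaE] then matches the first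
   eigenvalues, and the slope the second. *)
pose a := (Lambda 0 0 - Lambda 0 1) / (Lambda' 0 0 - Lambda' 0 1).
have a0 : a != 0 by rewrite mulf_neq0 ?invr_neq0.
have LambdaE : Lambda = a *: Lambda' + const_mx (Lambda 0 0 - a * Lambda' 0 0).
  apply/rowP => i; rewrite !mxE.
  case: (eqVneq i 0) => [->|i0]; first by ring.
  have -> : i = 1 by case: i i0 => [[|[|k]] lt_i2] // _; apply: val_inj.
  by rewrite /a; field.
exists (a ^+ 2); split=> [|d _ rho _]; first by rewrite exprn_even_gt0.
by rewrite {1}LambdaE lqu_affine.
Qed.
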